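(* Let $(M,h)$ be a Hermitian manifold of complex dimension $n\ge2$, and let $F=\rho(z)\,\|\eta\|_h$ be the conformal solution of the generalized Zermelo navigation problem with data $(h,\|u\|_h,W)$. Then $F$ and $h$ are projectively related if and only if $\rho$ is constant (i.e. $\|u(z)\|_h$ is constant when $W=0$, or $\tilde\varepsilon=\|u(z)\|_h^2-\|W\|_h^2$ is constant when $W\neq0$ and $\cos\varphi=0$). Moreover, any of these assertions implies $\overset{h}{G^i}=G^i$, $\overset{h}{\theta^{*i}}=\theta^{*i}$ and $\mathcal{K}_F=\frac{1}{\rho^2}\mathcal{K}_h$.
   Context: $M$ is a connected complex manifold with local coordinates $z=(z^k)$; $(z,\eta)$ are the induced coordinates on the holomorphic tangent bundle $T'M$; summation convention; $\dot\partial_k=\partial/\partial\eta^k$; barred indices denote conjugates. Conformal solution: the data are a Hermitian metric $h$ on $M$, a smooth section $W$ of $T'M$ (the wind) and a smooth function $\|u\|_h$ on $M$ with $\|W\|_h<\|u\|_h\le1$, where $\|\eta\|_h=\sqrt{h_{i\bar j}\eta^i\bar\eta^j}$. In either of the two cases ''$W=0$'' or ''$W$ nowhere zero and $\cos\varphi=0$'' (where $\varphi=\arg h(v,\bar W)$ is the constant angle, $v$ being the resultant velocity; $\cos\varphi=0$ means that $v$ and $W$ are orthogonal), the solution of the generalized Zermelo navigation problem is the Hermitian metric $F(z,\eta)=\rho(z)\|\eta\|_h$ with $\rho=\frac{1}{\|u\|_h}$ in the first case, and $\rho=\frac{1}{\sqrt{\tilde\varepsilon}}$, $\tilde\varepsilon=\|u\|_h^2-\|W\|_h^2$,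 in the second. For a metric $F$ with fundamental tensor $g_{i\bar j}=\frac{\partial^2F^2}{\partial\eta^i\partial\bar\eta^j}$ (so $g_{i\bar j}=\rho^2h_{i\bar j}$ here), put $N^i_j=g^{\bar m i}\frac{\partial g_{l\bar m}}{\partial z^j}\eta^l$, $L^i_{jk}=\dot\partial_jN^i_k$, spray coefficients $G^i=\frac12N^i_j\eta^j$, $\theta^{*i}=g^{\bar mi}g_{h\bar p}(L^{\bar p}_{\bar j\bar m}-L^{\bar p}_{\bar m\bar j})\eta^h\bar\eta^j$ (with $L^{\bar p}_{\bar j\bar m}=\overline{L^p_{jm}}$), and holomorphic curvature $\mathcal{K}_F(z,\eta)=-\frac{4}{F^4}g_{k\bar m}\frac{\partial G^k}{\partial\bar z^h}\bar\eta^h\bar\eta^m$. The objects of $h$ (i.e. of $\|\eta\|_h$) are written $\overset{h}{G^i},\overset{h}{\theta^{*i}},\mathcal{K}_h$. Two metrics $F,\tilde F$ on $M$ are projectively related if they have the same complex geodesics as point sets, equivalently $\tilde G^i=G^i+\frac12(\tilde\theta^{*i}-\theta^{*i})+P\eta^i$ for some smooth complex-valued function $P$ on $T'M\setminus0$. *)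

(* Defs.v *)
From HB Require Import structures.
From mathcomp Require Export all_boot all_order all_algebra.
From mathcomp Require Export all_classical all_reals all_analysis.
From mathcomp Require Export complex.
From mathcomp Require Import ring lra.
Export Order.TTheory GRing.Theory Num.Theory.
Export numFieldNormedType.Exports.

Set Implicit Arguments.
Unset Strict Implicit.
Unset Printing Implicit Defensive.

Local Open Scope classical_set_scope.
Local Open Scope complex_scope.
Local Open Scope ring_scope.

(* Seeing R[i] as a numClosedFieldType is what gives it, and 'rV[Cplx R]_n,
   their topology and their (complex) normed module structure. *)
Definition Cplx (R : realType) : numClosedFieldType := R[i].

Section Wirtinger.
Context {R : realType} {m : nat}.
Local Notation C := (Cplx R).
Implicit Types (f : 'rV[C]_m -> C) (v z : 'rV[C]_m).

Definition rline v z (t : R) : 'rV[C]_m := z + (t%:C : C) *: v.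

(* Derivative along the real line through z directed by v. *)
Definition rderivable f v z : Prop :=
  derivable (fun t : R => complex.Re (f (rline v z t)) : R) 0 1 /\
  derivable (fun t : R => complex.Im (f (rline v z t)) : R) 0 1.

Definition rderive f v z : C :=
  derive1 (fun t : R => complex.Re (f (rline v z t)) : R) 0 +i*
  derive1 (fun t : R => complex.Im (f (rline v z t)) : R) 0.

(* The real coordinate directions d/dx^k (false) and d/dy^k (true). *)
Definition rdir (b : bool) (k : 'I_m) : 'rV[C]_m :=
  (if b then 'i else 1) *: delta_mx 0 k.

Definition dz (k : 'I_m) f z : C :=
  2^-1 * (rderive f (rdir false k) z - 'i * rderive f (rdir true k) z).

Definition dzbar (k : 'I_m) f z : C :=
  2^-1 * (rderive f (rdir false k) z + 'i * rderive f (rdir true k) z).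

(* Real differentiability classes C^r on an open set U. *)
Fixpoint of_class (r : nat) (U : set 'rV[C]_m) f : Prop :=
  (forall z, U z -> {for z, continuous f}) /\
  match r with
  | 0 => True
  | r'.+1 => forall b k,
      (forall z, U z -> rderivable f (rdir b k) z) /\
      of_class r' U (rderive f (rdir b k))
  end.

Definition smooth_on (U : set 'rV[C]_m) f : Prop := forall r, of_class r U f.

End Wirtinger.

(* A complex manifold of dimension n given by a holomorphic atlas; the charts
   and their inverses are total functions, meaningful only on chart_dom i and
   chart_cod i. *)
Record complexManifold (R : realType) (n : nat) := ComplexManifold {
  cm_space :> topologicalType;
  cm_hausdorff : hausdorff_space cm_space;
  cm_second_countable : @second_countable cm_space;
  chart_idx : Type;
  chart_dom : chart_idx -> set cm_space;
  chart_cod : chart_idx -> set 'rV[Cplx R]_n;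
  chart : chart_idx -> cm_space -> 'rV[Cplx R]_n;
  chart_inv : chart_idx -> 'rV[Cplx R]_n -> cm_space;
  chart_cover : forall p, exists i, chart_dom i p;
  chart_dom_open : forall i, open (chart_dom i);
  chart_cod_open : forall i, open (chart_cod i);
  chart_in : forall i p, chart_dom i p -> chart_cod i (chart i p);
  chart_inv_in : forall i z, chart_cod i z -> chart_dom i (chart_inv i z);
  chartK : forall i p, chart_dom i p -> chart_inv i (chart i p) = p;
  chart_invK : forall i z, chart_cod i z -> chart i (chart_inv i z) = z;
  chart_cont : forall i p, chart_dom i p -> {for p, continuous (chart i)};
  chart_inv_cont : forall i z,
    chart_cod i z -> {for z, continuous (chart_inv i)};
  chart_holo : forall i j z, chart_cod i z -> chart_dom j (chart_inv i z) ->
    differentiable (chart j \o chart_inv i) z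
}.

Section Bundles.
Context {R : realType} {n : nat} (M : complexManifold R n).
Local Notation C := (Cplx R).
Local Notation I := (chart_idx M).

Definition transition (i j : I) : 'rV[C]_n -> 'rV[C]_n :=
  @chart R n M j \o @chart_inv R n M i.

Definition overlap (i j : I) : set 'rV[C]_n :=
  [set z | chart_cod i z /\ chart_dom j (chart_inv i z)].

(* The fibre coordinates of T'M change by eta |-> eta *m transJ i j z. *)
Definition transJ (i j : I) (z : 'rV[C]_n) : 'M[C]_n :=
  jacobian (transition i j) z.

Definition smooth_fun (u : M -> R) : Prop :=
  forall i : I, smooth_on (chart_cod i) (fun z => (u (chart_inv i z))%:C : C).

(* A function on T'M, by its expressions in the induced coordinates (z, eta). *)
Definition tangent_fun (T : Type) := I -> 'rV[C]_n -> 'rV[C]_n -> T.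

Definition smooth_slit (P : tangent_fun C) : Prop :=
  (forall i j z eta, overlap i j z -> eta != 0 ->
     P j (transition i j z) (eta *m transJ i j z) = P i z eta) /\
  (forall i, smooth_on
     [set x : 'rV[C]_(n + n) | chart_cod i (lsubmx x) /\ rsubmx x != 0]
     (fun x => P i (lsubmx x) (rsubmx x))).

(* h(v, \bar w) for the coefficient matrix H = (h_{k \bar l}) *)
Definition hform (H : 'M[C]_n) (v w : 'rV[C]_n) : C :=
  \sum_k \sum_l H k l * v 0 k * (w 0 l)^*.

Definition hnorm (H : 'M[C]_n) (v : 'rV[C]_n) : R :=
  Num.sqrt (complex.Re (hform H v v)).

Record hermitianMetric := HermitianMetric {
  hcoef :> I -> 'rV[C]_n -> 'M[C]_n;
  hcoef_smooth : forall i k l, smooth_on (chart_cod i) (fun z => hcoef i z k l);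
  hcoef_herm : forall i z k l,
    chart_cod i z -> hcoef i z l k = (hcoef i z k l)^*;
  (* 0 < _ in R[i] means real and positive *)
  hcoef_pos : forall i z v, chart_cod i z -> v != 0 -> 0 < hform (hcoef i z) v v;
  hcoef_change : forall i j z, overlap i j z ->
    hcoef i z = transJ i j z *m hcoef j (transition i j z)
                *m (map_mx Num.conj (transJ i j z))^T
}.

Record tangentSection := TangentSection {
  tcoef :> I -> 'rV[C]_n -> 'rV[C]_n;
  tcoef_smooth : forall i k, smooth_on (chart_cod i) (fun z => tcoef i z 0 k);
  tcoef_change : forall i j z, overlap i j z ->
    tcoef j (transition i j z) = tcoef i z *m transJ i j z
}.

Definition norm_metric (h : hermitianMetric) : tangent_fun R :=
  fun i z eta => hnorm (h i z) eta.

Definition conformal_metric (h : hermitianMetric) (rho : M -> R) :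
    tangent_fun R :=
  fun i z eta => rho (chart_inv i z) * hnorm (h i z) eta.

End Bundles.

(* The geometric objects of a metric, from its expression F(z, eta) in one
   coordinate system. *)
Section LocalObjects.
Context {R : realType} {n : nat}.
Local Notation C := (Cplx R).
Variable F : 'rV[C]_n -> 'rV[C]_n -> R.
Implicit Types (z eta : 'rV[C]_n) (i j k : 'I_n).

Definition fund z eta : 'M[C]_n :=
  \matrix_(i, j)
    dz i (fun eta1 => dzbar j (fun eta2 => (F z eta2 ^+ 2)%:C : C) eta1) eta.

(* g^{\bar m i} is the entry (m, i) of the inverse of (g_{i \bar m}) *)
Definition fund_inv z eta : 'M[C]_n := invmx (fund z eta).

Definition nconn i j z eta : C :=
  \sum_m \sum_l fund_inv z eta m i * dz j (fun z1 => fund z1 eta l m) z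
                * eta 0 l.

Definition lconn i j k z eta : C := dz j (fun eta1 => nconn i k z eta1) eta.

Definition spray i z eta : C := 2^-1 * \sum_j nconn i j z eta * eta 0 j.

Definition theta_star i z eta : C :=
  \sum_m \sum_h \sum_p \sum_j
    fund_inv z eta m i * fund z eta h p
    * ((lconn p j m z eta)^* - (lconn p m j z eta)^*)
    * eta 0 h * (eta 0 j)^*.

Definition holo_curv z eta : C :=
  - (4 / (F z eta ^+ 4)%:C) *
  \sum_k \sum_m \sum_h
    fund z eta k m * dzbar h (fun z1 => spray k z1 eta) z
    * (eta 0 h)^* * (eta 0 m)^*.

End LocalObjects.

Section Zermelo.
Context {R : realType} {n : nat} (M : complexManifold R n).
Local Notation C := (Cplx R).

(* The two metrics have the same complex geodesics as point sets, in terms of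
   their spray coefficients; P is one global function on T'M minus the zero
   section. *)
Definition projectively_related (F F' : tangent_fun M R) : Prop :=
  exists P : tangent_fun M C, smooth_slit P /\
    forall i z eta k, chart_cod i z -> eta != 0 ->
      spray (F' i) k z eta =
        spray (F i) k z eta
        + 2^-1 * (theta_star (F' i) k z eta - theta_star (F i) k z eta)
        + P i z eta * eta 0 k.

Record navigationData := NavigationData {
  nav_metric : hermitianMetric M;
  nav_wind : tangentSection M;
  nav_speed : M -> R; (* the function ||u||_h *)
  nav_speed_smooth : smooth_fun nav_speed;
  nav_mild : forall i z, chart_cod i z ->
    hnorm (nav_metric i z) (nav_wind i z) < nav_speed (chart_inv i z) <= 1
}.

Variable D : navigationData.
Local Notation h := (nav_metric D).
Local Notation W := (nav_wind D).
Local Notation speed := (nav_speed D).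

Definition wind_zero : Prop := forall i z, chart_cod i z -> W i z = 0.

Definition wind_nowhere_zero : Prop :=
  forall i z, chart_cod i z -> W i z != 0.

Definition eps_tilde (i : chart_idx M) (z : 'rV[C]_n) : R :=
  speed (chart_inv i z) ^+ 2 - hnorm (h i z) (W i z) ^+ 2.

(* F solves the navigation problem when its unit vectors v = eta / F are
   resultant velocities: ||v - W||_h = ||u||_h, expanded with
   Re h(v, \bar W) = |h(v, \bar W)| cos phi for the constant angle
   phi = arg h(v, \bar W). *)
Definition navigation_solution (phi : R) (F : tangent_fun M R) : Prop :=
  forall i z eta, chart_cod i z -> eta != 0 ->
    0 < F i z eta /\
    let v := ((F i z eta)^-1%:C : C) *: eta in
    hnorm (h i z) v ^+ 2
      - 2 * complex.Re `|hform (h i z) v (W i z)| * cos phi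
      + hnorm (h i z) (W i z) ^+ 2
    = speed (chart_inv i z) ^+ 2.

Definition conformal_case (phi : R) (rho : M -> R) : Prop :=
  (wind_zero /\
   forall i z, chart_cod i z ->
     rho (chart_inv i z) = (speed (chart_inv i z))^-1) \/
  [/\ wind_nowhere_zero, cos phi = 0 &
   forall i z, chart_cod i z ->
     rho (chart_inv i z) = (Num.sqrt (eps_tilde i z))^-1].

(* The first clause follows from the second (conformal_case_solution). *)
Definition conformal_solution (phi : R) (rho : M -> R) : Prop :=
  navigation_solution phi (conformal_metric h rho) /\ conformal_case phi rho.

Lemma hform0r (H : 'M[C]_n) v : hform H v 0 = 0.
Proof.
rewrite /hform big1 // => k _; rewrite big1 // => l _.
by rewrite mxE rmorph0 mulr0.
Qed.

Lemma hformZ (H : 'M[C]_n) (a : R) v :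
  hform H ((a%:C : C) *: v) ((a%:C : C) *: v) = (a ^+ 2)%:C * hform H v v.
Proof.
rewrite /hform mulr_sumr; apply: eq_bigr => k _; rewrite mulr_sumr.
apply: eq_bigr => l _; rewrite !mxE rmorphM /=.
have -> : (a%:C : C)^* = a%:C by apply/eqP; rewrite eq_complex /= oppr0 !eqxx.
rewrite rmorphXn /= expr2; set b : C := a%:C; set c : C := H k l.
by set d := (v 0 l)^*; ring.
Qed.

Lemma hnorm_sqr i z v : chart_cod i z -> v != 0 ->
  0 < complex.Re (hform (h i z) v v).
Proof.
move=> zi v0; have := hcoef_pos h zi v0.
by rewrite ltcE /= => /andP[].
Qed.

Lemma conformal_case_solution (phi : R) (rho : M -> R) :
  conformal_case phi rho -> navigation_solution phi (conformal_metric h rho).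
Proof.
move=> hc i z eta zi eta0.
have q0 := hnorm_sqr zi eta0.
have n0 : 0 < hnorm (h i z) eta by rewrite /hnorm sqrtr_gt0.
have nq : hnorm (h i z) eta ^+ 2 = complex.Re (hform (h i z) eta eta).
  by rewrite /hnorm sqr_sqrtr // ltW.
have /andP[wu _] := nav_mild D zi.
have w0 : 0 <= hnorm (h i z) (W i z) by exact: sqrtr_ge0.
have u0 : 0 < speed (chart_inv i z) by exact: le_lt_trans wu.
have e0 : 0 < eps_tilde i z by rewrite subr_gt0 ltr_pXn2r // nnegrE // ltW.
have scale a : hnorm (h i z) ((a%:C : C) *: eta) ^+ 2
    = a ^+ 2 * hnorm (h i z) eta ^+ 2.
  have re : complex.Re (hform (h i z) ((a%:C : C) *: eta) ((a%:C : C) *: eta))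
      = a ^+ 2 * complex.Re (hform (h i z) eta eta).
    by rewrite hformZ; case: (hform _ _ _) => x y /=; ring.
  rewrite nq {1}/hnorm re sqr_sqrtr // mulr_ge0 // ?sqr_ge0 // ltW //.
case: hc => [[W0 hr]|[_ c0 hr]]; rewrite /conformal_metric /= hr //.
  split; first by rewrite mulr_gt0 // invr_gt0.
  have nc0 : Normc.normc (0 : R[i]) = 0 :> R.
    by rewrite /Normc.normc /= expr0n addr0 sqrtr0.
  rewrite W0 // !hform0r nc0 mulr0 mul0r subr0 scale /hnorm hform0r /=.
  rewrite sqrtr0 expr0n addr0 -/(hnorm (h i z) eta).
  by field; rewrite ?gt_eqF.
have s0 : 0 < Num.sqrt (eps_tilde i z) by rewrite sqrtr_gt0.
split; first by rewrite mulr_gt0 // invr_gt0.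
rewrite c0 mulr0 subr0 scale.
have -> : ((Num.sqrt (eps_tilde i z))^-1 * hnorm (h i z) eta)^-1 ^+ 2
    * hnorm (h i z) eta ^+ 2 = Num.sqrt (eps_tilde i z) ^+ 2.
  by field; rewrite ?gt_eqF.
by rewrite sqr_sqrtr ?ltW // /eps_tilde subrK.
Qed.

End Zermelo.

(* Main.v *)
Require Import Defs.
From mathcomp Require Import ring lra.

(* Write F^2 = r |eta|_h^2 with r = rho^2. Then g = r h, and the product rule
   turns the objects of F into those of h plus terms in s = d(log r):
     G^i = G_h^i + (s.eta) eta^i / 2,
     theta^i = theta_h^i + h^{m i} conj(s_m) |eta|_h^2 - conj(s.eta) eta^i.
   Projective relatedness therefore says that the gradient h^{m i} conj(s_m) is
   proportional to eta for every eta <> 0; testing on coordinate vectors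
   (n >= 2) gives s = 0, so the real function r is locally constant, hence
   constant. Conversely s = 0 makes sprays and torsions agree, with P = 0. *)

Set Implicit Arguments.
Unset Strict Implicit.
Unset Printing Implicit Defensive.

Local Open Scope classical_set_scope.
Local Open Scope complex_scope.
Local Open Scope ring_scope.

(** * Real and imaginary parts of complex operations *)

Section ComplexParts.
Context {R : realType}.
Implicit Types x y : Cplx R.

Lemma Cplx_eqP x y :
  complex.Re x = complex.Re y -> complex.Im x = complex.Im y -> x = y.
Proof. by case: x => a b; case: y => c d /= -> ->. Qed.

Lemma ReD x y : complex.Re (x + y) = complex.Re x + complex.Re y.
Proof. by case: x; case: y. Qed.

Lemma ImD x y : complex.Im (x + y) = complex.Im x + complex.Im y.
Proof. by case: x; case: y. Qed.

Lemma ReM x y : complex.Re (x * y) =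
  complex.Re x * complex.Re y - complex.Im x * complex.Im y.
Proof. by case: x; case: y. Qed.

Lemma ImM x y : complex.Im (x * y) =
  complex.Re x * complex.Im y + complex.Im x * complex.Re y.
Proof. by case: x; case: y => a b c d /=; rewrite addrC mulrC addrC mulrC. Qed.

Lemma ReJ x : complex.Re (x^*) = complex.Re x.
Proof. by case: x. Qed.

Lemma ImJ x : complex.Im (x^*) = - complex.Im x.
Proof. by case: x. Qed.

Lemma conj_i : ('i : Cplx R)^* = - 'i.
Proof. exact: conjCi. Qed.

End ComplexParts.

(** * Derivatives of complex functions along real lines *)

Section RealLineDerivative.
Context {R : realType} {m : nat}.
Local Notation C := (Cplx R).
Implicit Types (f g : 'rV[C]_m -> C) (v z : 'rV[C]_m).

Definition is_rderive f v z (d : C) : Prop :=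
  is_derive (0 : R) 1 (fun t : R => complex.Re (f (rline v z t)) : R)
    (complex.Re d) /\
  is_derive (0 : R) 1 (fun t : R => complex.Im (f (rline v z t)) : R)
    (complex.Im d).

Lemma rline0 v z : rline v z 0 = z.
Proof. by rewrite /rline scale0r addr0. Qed.

Lemma rderive_val f v z d : is_rderive f v z d -> rderive f v z = d.
Proof.
move=> [h1 h2]; rewrite /rderive !derive1E (@derive_val _ _ _ _ _ _ _ h1)
  (@derive_val _ _ _ _ _ _ _ h2).
by case: d {h1 h2}.
Qed.

Lemma rderivableP f v z : rderivable f v z -> is_rderive f v z (rderive f v z).
Proof.
by move=> [h1 h2]; split; rewrite /rderive /= derive1E; exact: derivableP.
Qed.

Lemma is_rderive_eq f v z d d' : is_rderive f v z d -> d = d' ->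
  is_rderive f v z d'.
Proof. by move=> h <-. Qed.

Lemma is_rderive_cst (a : C) v z : is_rderive (fun=> a) v z 0.
Proof. by split; exact: is_derive_cst. Qed.

Lemma is_rderiveD f g v z a b :
  is_rderive f v z a -> is_rderive g v z b ->
  is_rderive (fun x => f x + g x) v z (a + b).
Proof.
move=> [f1 f2] [g1 g2]; split.
- rewrite ReD; under eq_fun do rewrite ReD; exact: is_deriveD.
- rewrite ImD; under eq_fun do rewrite ImD; exact: is_deriveD.
Qed.

Lemma is_rderiveM f g v z a b :
  is_rderive f v z a -> is_rderive g v z b ->
  is_rderive (fun x => f x * g x) v z (a * g z + f z * b).
Proof.
move=> [f1 f2] [g1 g2]; split.
- rewrite ReD !ReM; under eq_fun do rewrite ReM.
  apply: is_derive_eq; rewrite !rline0 /GRing.scale /=; ring.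
- rewrite ImD !ImM; under eq_fun do rewrite ImM.
  apply: is_derive_eq; rewrite !rline0 /GRing.scale /=; ring.
Qed.

Lemma is_rderiveJ f v z a :
  is_rderive f v z a -> is_rderive (fun x => (f x)^*) v z (a^*).
Proof.
move=> [f1 f2]; split.
- by rewrite ReJ; under eq_fun do rewrite ReJ.
- rewrite ImJ; under eq_fun do rewrite ImJ; exact: is_deriveN.
Qed.

Lemma is_rderive_coord k v z : is_rderive (fun x => x 0 k) v z (v 0 k).
Proof.
split.
- under eq_fun do rewrite !mxE ReD ReM /= mul0r subr0.
  by apply: is_derive_eq; rewrite /GRing.scale /=; ring.
- under eq_fun do rewrite !mxE ImD ImM /= mul0r addr0.
  by apply: is_derive_eq; rewrite /GRing.scale /=; ring.
Qed.

Lemma near_rline v z (P : set 'rV[C]_m) : nbhs z P ->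
  \forall t \near (0 : R), P (rline v z t).
Proof.
move=> /nbhs_ballP[e /= e0 he].
(* Radii and norms live in the complex field, where a positive or nonnegative element is real; the
   estimate is thus carried over to [R]. *)
have e1 : (complex.Re e)%:C = e by apply: RRe_real; exact: gtr0_real.
have v1 : (complex.Re `|v|)%:C = `|v| by apply: RRe_real; exact: normr_real.
have v0 : 0 <= complex.Re `|v| by rewrite -lecR v1; exact: normr_ge0.
(* The summand 1 keeps the denominator positive when [v] is zero. *)
have d0 : 0 < complex.Re e / (1 + complex.Re `|v|).
  by rewrite divr_gt0 // ?ltr_wpDr // -ltcR e1.
have near0 := @nbhs0_lt R R _ d0.
near=> t; apply: he.
rewrite -ball_normE /ball_ /= /rline opprD addNKr normrN normrZ.
have -> : `|t%:C : Cplx R| = `|t|%:C.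
  by rewrite normc_def /= expr0n addr0 sqrtr_sqr.
rewrite -e1 -v1 -rmorphM /= ltcR.
have : `|t| < complex.Re e / (1 + complex.Re `|v|).
  by near: t.
rewrite ltr_pdivlMr ?ltr_wpDr //; apply: le_lt_trans.
by rewrite ler_wpM2l // lerDr.
Unshelve. all: by end_near.
Qed.

Lemma near_is_rderive f g v z a : (\forall x \near z, f x = g x) ->
  is_rderive f v z a -> is_rderive g v z a.
Proof.
move=> /(near_rline v) fg [f1 f2]; split.
- apply: near_eq_is_derive f1; apply: filterS fg => t -> //.
- apply: near_eq_is_derive f2; apply: filterS fg => t -> //.
Qed.

Lemma near_rderive f g v z : (\forall x \near z, f x = g x) ->
  rderive f v z = rderive g v z.
Proof.
move=> /(near_rline v) fg; rewrite /rderive !derive1E; congr (_ +i* _).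
- apply: near_eq_derive; apply: filterS fg => t -> //.
- apply: near_eq_derive; apply: filterS fg => t -> //.
Qed.

End RealLineDerivative.

(** * Product, sum and conjugation rules for the Wirtinger derivatives *)

Section WirtingerCalculus.
Context {R : realType} {m : nat}.
Local Notation C := (Cplx R).
Implicit Types (f g : 'rV[C]_m -> C) (z : 'rV[C]_m) (k : 'I_m).

(* df/dz^k = a and df/dzbar^k = b, expressed through
   df/dx^k = a + b and df/dy^k = i (a - b). *)
Definition has_dz k f z (a b : C) : Prop :=
  is_rderive f (rdir false k) z (a + b) /\
  is_rderive f (rdir true k) z ('i * (a - b)).

Lemma dz_val k f z a b : has_dz k f z a b -> dz k f z = a.
Proof.
move=> [h1 h2]; rewrite /dz (rderive_val h1) (rderive_val h2) mulrA.
by rewrite -expr2 sqrCi; field.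
Qed.

Lemma dzbar_val k f z a b : has_dz k f z a b -> dzbar k f z = b.
Proof.
move=> [h1 h2]; rewrite /dzbar (rderive_val h1) (rderive_val h2) mulrA.
by rewrite -expr2 sqrCi; field.
Qed.

Lemma has_dzP k f z : (forall b, rderivable f (rdir b k) z) ->
  has_dz k f z (dz k f z) (dzbar k f z).
Proof.
move=> h; split; apply: is_rderive_eq (rderivableP (h _)) _.
  rewrite /dz /dzbar; move: (rderive _ _ _) (rderive _ _ _) => x y; by field.
rewrite /dz /dzbar; move: (rderive _ _ _) (rderive _ _ _) => x y.
have -> : 'i * (2^-1 * (x - 'i * y) - 2^-1 * (x + 'i * y))
   = - ('i ^+ 2) * y :> C by field.
by rewrite sqrCi opprK mul1r.
Qed.

Lemma has_dz_eq k f z a b a' b' :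
  has_dz k f z a b -> a = a' -> b = b' -> has_dz k f z a' b'.
Proof. by move=> h <- <-. Qed.

Lemma has_dz_cst k (c : C) z : has_dz k (fun=> c) z 0 0.
Proof.
by split; apply: is_rderive_eq (is_rderive_cst _ _ _) _; rewrite ?subrr; ring.
Qed.

Lemma has_dzD k f g z a b a' b' : has_dz k f z a b -> has_dz k g z a' b' ->
  has_dz k (fun x => f x + g x) z (a + a') (b + b').
Proof.
move=> [f1 f2] [g1 g2]; split.
- by apply: is_rderive_eq (is_rderiveD f1 g1) _; ring.
- by apply: is_rderive_eq (is_rderiveD f2 g2) _; ring.
Qed.

Lemma has_dzM k f g z a b a' b' : has_dz k f z a b -> has_dz k g z a' b' ->
  has_dz k (fun x => f x * g x) z (a * g z + f z * a') (b * g z + f z * b').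
Proof.
move=> [f1 f2] [g1 g2]; split.
- by apply: is_rderive_eq (is_rderiveM f1 g1) _; ring.
- by apply: is_rderive_eq (is_rderiveM f2 g2) _; ring.
Qed.

Lemma has_dzJ k f z a b : has_dz k f z a b ->
  has_dz k (fun x => (f x)^*) z (b^*) (a^*).
Proof.
move=> [f1 f2]; split.
- by apply: is_rderive_eq (is_rderiveJ f1) _; rewrite rmorphD /= addrC.
- apply: is_rderive_eq (is_rderiveJ f2) _.
  by rewrite rmorphM /= conj_i rmorphB /=; ring.
Qed.

Lemma has_dz_coord k l z : has_dz k (fun x => x 0 l) z (l == k)%:R 0.
Proof.
split; apply: is_rderive_eq (is_rderive_coord _ _ _) _;
  by rewrite !mxE eqxx /= ?addr0 ?subr0 ?mul1r.
Qed.

Lemma has_dz_sum (I : Type) (r : seq I) (P : pred I) k z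
    (f : I -> 'rV[C]_m -> C) (a b : I -> C) :
  (forall i, P i -> has_dz k (f i) z (a i) (b i)) ->
  has_dz k (fun x => \sum_(i <- r | P i) f i x) z
    (\sum_(i <- r | P i) a i) (\sum_(i <- r | P i) b i).
Proof.
move=> h; elim: r => [|i r IH].
  under eq_fun do rewrite big_nil.
  by rewrite !big_nil; exact: has_dz_cst.
under eq_fun do rewrite big_cons.
rewrite !big_cons; case: ifP => // Pi; exact: has_dzD (h i Pi) IH.
Qed.

Lemma near_has_dz k f g z a b : (\forall x \near z, f x = g x) ->
  has_dz k f z a b -> has_dz k g z a b.
Proof.
by move=> fg [f1 f2]; split; [move: f1|move: f2]; exact: near_is_rderive.
Qed.

Lemma near_dz k f g z : (\forall x \near z, f x = g x) ->
  dz k f z = dz k g z.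
Proof. by move=> fg; rewrite /dz !(near_rderive _ fg). Qed.

Lemma near_dzbar k f g z : (\forall x \near z, f x = g x) ->
  dzbar k f z = dzbar k g z.
Proof. by move=> fg; rewrite /dzbar !(near_rderive _ fg). Qed.

End WirtingerCalculus.

(** * Vanishing real derivatives on a polydisc force a constant function *)

Section LocallyConstant.
Context {R : realType} {m : nat}.
Local Notation C := (Cplx R).
Implicit Types (r : 'rV[C]_m -> R) (v x z w : 'rV[C]_m).

(** Directional derivatives are taken at parameter 0 only; this moves them to any point of the
    line. *)
Lemma is_derive_translate (g : R -> R) (t d : R) :
  is_derive (0 : R) 1 (fun s => g (t + s)) d -> is_derive t 1 g d.
Proof.
move=> h.
have -> : g = (fun s => g (t + s)) \o (fun u => u - t).
  by apply/funext => u /=; rewrite addrC subrK.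
rewrite -[d]mulr1; apply: is_derive1_comp; rewrite ?subrr //.
by apply: is_derive_eq; rewrite oppr0 addr0.
Qed.

Lemma rline_add v x (s t : R) : rline v (rline v x s) t = rline v x (s + t).
Proof. by rewrite /rline -addrA -scalerDl -rmorphD. Qed.

(** Mean value theorem for [r] restricted to the line. The assumption is symmetric in the sign of
    [t], so it covers the segment between 0 and [a] for both signs of [a]. *)
Lemma rline_const r v x (a : R) :
  (forall t : R, `|t| <= `|a| ->
     is_rderive (fun y => (r y)%:C : C) v (rline v x t) 0) ->
  r (rline v x a) = r x.
Proof.
move=> h; rewrite -{2}(rline0 v x).
pose g t := r (rline v x t); change (g a = g 0).
have dg (t : R) : `|t| <= `|a| -> is_derive t 1 g 0.
  move=> /h[/= + _]; under eq_fun do rewrite rline_add.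
  exact: is_derive_translate.
have key b c : b <= c -> (forall t, b <= t <= c -> `|t| <= `|a|) -> g c = g b.
  move=> bc hbc.
  have [t /[!in_itv]/= tbc||t _] := @MVT_segment R g (fun=> 0) b c bc.
  - by apply: dg; apply: hbc; lra.
  - apply: derivable_within_continuous => t /[!in_itv]/= tbc.
    exact: (@ex_derive _ _ _ _ _ _ _ (dg t (hbc t tbc))).
  - by rewrite mul0r => /subr0_eq.
have [a0|a0] := leP 0 a; last (symmetry).
  by apply: key => // t /andP[t0 ta]; rewrite !ger0_norm.
apply: key => [|t /andP[ta t0]]; first exact: ltW.
by rewrite !ler0_norm ?lerN2 // ltW.
Qed.

(** Keeps the intermediate points of a horizontal-then-vertical path inside the disc that contains
    its end. *)
Lemma le_normc (a b c d : R) : `|a| <= `|c| -> `|b| <= `|d| ->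
  `|a +i* b : C| <= `|c +i* d : C|.
Proof.
move=> ac bd; rewrite !normc_def /= lecR ler_sqrt ?addr_ge0 ?sqr_ge0 //.
have sq (p q : R) : `|p| <= `|q| -> p ^+ 2 <= q ^+ 2.
  move=> pq; rewrite -(real_normK (num_real p)) -(real_normK (num_real q)).
  by rewrite lerXn2r ?nnegrE.
by rewrite lerD // sq.
Qed.

(** The points [z] and [w] are joined by a path that changes one coordinate at a time, first in its
    real and then in its imaginary part. The path stays in the polydisc, and [r] is constant on each
    leg. *)
Lemma ball_const r z (e : C) :
  (forall x, (forall j, `|x 0 j - z 0 j| < e) -> forall b k,
     is_rderive (fun y => (r y)%:C : C) (rdir b k) x 0) ->
  forall w, (forall j, `|w 0 j - z 0 j| < e) -> r w = r z.
Proof.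
move=> h w hw.
have step x k (c : C) : (forall j, `|x 0 j - z 0 j| < e) -> x 0 k = z 0 k ->
    `|c| < e -> r (x + c *: delta_mx 0 k) = r x.
  move=> hx xk ce.
  have box (a b : R) : `|a| <= `|complex.Re c| -> `|b| <= `|complex.Im c| ->
      forall j, `|(x + (a +i* b : C) *: delta_mx 0 k) 0 j - z 0 j| < e.
    move=> ac bc j; rewrite !mxE eqxx /=.
    have [->|_] := eqVneq j k; last by rewrite mulr0 addr0.
    rewrite xk mulr1 addrAC subrr add0r.
    case: c ce ac bc => p q ce /le_normc h1 /h1 h2.
    exact: (le_lt_trans h2 ce).
  have ab (a b : R) : rline (rdir true k) (rline (rdir false k) x a) b =
      x + (a +i* b : C) *: delta_mx 0 k.
    rewrite /rline /rdir !scalerA -addrA -scalerDl; congr (_ + _ *: _).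
    by apply: Cplx_eqP; rewrite !(ReD, ImD, ReM, ImM) /=; ring.
  have a0 (a : R) : rline (rdir false k) x a =
      x + (a +i* 0 : C) *: delta_mx 0 k.
    by rewrite -ab rline0.
  have -> : c = complex.Re c +i* complex.Im c by case: (c).
  (* The vertical leg is removed first, then the horizontal one. *)
  rewrite -ab (rline_const (r := r)); last first.
    by move=> t tc; rewrite ab; apply: h; exact: box.
  apply: rline_const => t tc; rewrite a0; apply: h; apply: box => //.
  by rewrite normr0.
(* The corner reached after [s] coordinates have been changed from those of [z] to those of [w]. *)
pose p (s : nat) : 'rV[C]_m :=
  \row_j (if (j < s)%N then w 0 j else z 0 j).
(* Positivity of [e] comes from the bound at a coordinate, hence the argument [j]: for [m = 0] there
   is none. *)
have e0 (j : 'I_m) : 0 < e by exact: (le_lt_trans (normr_ge0 _) (hw j)).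
have hp s j : `|p s 0 j - z 0 j| < e.
  by rewrite mxE; case: ifP => // _; rewrite subrr normr0 e0.
have pw : p m = w by apply/rowP => j; rewrite mxE ltn_ord.
have p0 : p 0%N = z by apply/rowP => j; rewrite mxE.
rewrite -pw -[in RHS]p0.
have : (m <= m)%N by [].
elim: {1 3}m => // s IH sm; rewrite -IH ?(ltnW sm) //.
pose k := Ordinal sm.
have -> : p s.+1 = p s + (w 0 k - z 0 k) *: delta_mx 0 k.
  apply/rowP => j; rewrite !mxE eqxx /=.
  have [->|jk] := eqVneq j k; first by rewrite /= ltnSn ltnn mulr1 addrC subrK.
  rewrite mulr0 addr0 ltnS leq_eqVlt; case: eqP => // js.
  by case/eqP: jk; apply: val_inj.
by apply: step => //; rewrite !mxE ltnn.
Qed.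
End LocallyConstant.

(** * Kronecker sums and Hermitian forms in the fibre coordinates *)

Lemma sum_delta (K : pzRingType) (n : nat) (f : 'I_n -> K) i :
  \sum_j f j * (j == i)%:R = f i.
Proof.
rewrite (bigD1 i) //= eqxx mulr1 big1 ?addr0 // => j /negPf ->.
by rewrite mulr0.
Qed.

Lemma sum_deltal (K : pzRingType) (n : nat) (f : 'I_n -> K) i :
  \sum_j (j == i)%:R * f j = f i.
Proof.
rewrite (bigD1 i) //= eqxx mul1r big1 ?addr0 // => j /negPf ->.
by rewrite mul0r.
Qed.

Section Polynomials.
Context {R : realType} {n : nat}.
Local Notation C := (Cplx R).
Implicit Types (H : 'M[C]_n) (eta : 'rV[C]_n).

Lemma has_dz_linear (c : 'I_n -> C) j eta :
  has_dz j (fun x => \sum_l c l * x 0 l) eta (c j) 0.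
Proof.
apply: has_dz_eq.
- apply: has_dz_sum => l _.
  exact: has_dzM (has_dz_cst _ _ _) (has_dz_coord _ _ _).
- by rewrite -[RHS](sum_delta c); apply: eq_bigr => l _; rewrite mul0r add0r.
- by rewrite big1 // => l _; rewrite mul0r mulr0 addr0.
Qed.

Lemma has_dz_hform H j eta :
  has_dz j (fun x => hform H x x) eta
    (\sum_l H j l * (eta 0 l)^*) (\sum_k H k j * eta 0 k).
Proof.
apply: has_dz_eq.
- apply: has_dz_sum => k _; apply: has_dz_sum => l _.
  apply: has_dzM; last exact: has_dzJ (has_dz_coord _ _ _).
  exact: has_dzM (has_dz_cst _ _ _) (has_dz_coord _ _ _).
- rewrite exchange_big; apply: eq_bigr => l _ /=.
  rewrite -(sum_delta (fun k => H k l * (eta 0 l)^*)); apply: eq_bigr => k _.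
  by rewrite mul0r add0r rmorph0 mulr0 addr0 mulrAC.
- apply: eq_bigr => k _ /=.
  rewrite -(sum_delta (fun l => H k l * eta 0 k)); apply: eq_bigr => l _.
  by rewrite mul0r mulr0 addr0 mul0r add0r conjC_nat.
Qed.

(** A nonzero row vector killed by [H] would satisfy [hform H v v = 0]. *)
Lemma hform_unitmx H : (forall v, v != 0 -> 0 < hform H v v) -> H \in unitmx.
Proof.
move=> Hpos; rewrite unitmxE unitfE; apply/negP => /det0P[v v0 vH].
have := Hpos v v0; suff -> : hform H v v = 0 by rewrite ltxx.
rewrite /hform exchange_big big1 //= => l _.
rewrite -mulr_suml; have /rowP/(_ l) := vH; rewrite !mxE => e.
by under eq_bigr do rewrite mulrC; rewrite e mul0r.
Qed.
End Polynomials.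

(** * Local objects of a metric with [F^2 = r h(eta, eta)], in one chart *)

Section ConformalChange.
Context {R : realType} {n : nat}.
Local Notation C := (Cplx R).
Variables (U : set 'rV[C]_n) (H : 'rV[C]_n -> 'M[C]_n) (r : 'rV[C]_n -> C).
Variable F : 'rV[C]_n -> 'rV[C]_n -> R.
Hypothesis Uo : open U.
Hypothesis dH : forall j k l z, U z -> has_dz j (fun x => H x k l) z
  (dz j (fun x => H x k l) z) (dzbar j (fun x => H x k l) z).
Hypothesis dr : forall j z, U z -> has_dz j r z (dz j r z) (dzbar j r z).
Hypothesis Hpos : forall z v, U z -> v != 0 -> 0 < hform (H z) v v.
Hypothesis r0 : forall z, U z -> r z != 0.
Hypothesis FE : forall z eta, U z ->
  (F z eta ^+ 2)%:C = r z * hform (H z) eta eta.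

(** The coefficients $L^i_{jk}$ of the Chern connection of [H]; they do not depend on the fibre
    coordinate. *)
Definition chern i j k z : C :=
  \sum_m invmx (H z) m i * dz k (fun x => H x j m) z.

(** The component $s_j$ of the holomorphic differential of $\log r$, written as a quotient because
    [r] is complex-valued here. *)
Definition dlog j z : C := dz j r z / r z.

Definition hspray i z (eta : 'rV[C]_n) : C :=
  2^-1 * \sum_j \sum_l chern i l j z * eta 0 l * eta 0 j.

Definition htheta i z (eta : 'rV[C]_n) : C :=
  \sum_m \sum_h \sum_p \sum_j
    invmx (H z) m i * H z h p * ((chern p j m z)^* - (chern p m j z)^*)
    * eta 0 h * (eta 0 j)^*.

(** $F^2$ is a Hermitian form in [eta]: one antiholomorphic derivative leaves a linear form, whose
    holomorphic derivative reads off the coefficients. *)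
Lemma fundE z eta : U z -> fund F z eta = r z *: H z.
Proof.
move=> zU; apply/matrixP => i j; rewrite !mxE.
have -> : (fun e => dzbar j (fun e' => (F z e' ^+ 2)%:C : C) e) =
    (fun e => \sum_k (r z * H z k j) * e 0 k).
  apply/funext => e; under eq_fun do rewrite FE //.
  rewrite (dzbar_val (has_dzM (has_dz_cst _ _ _) (has_dz_hform _ _ _))).
  by rewrite mul0r add0r mulr_sumr; apply: eq_bigr => k _; rewrite mulrA.
exact: dz_val (has_dz_linear _ _ _).
Qed.

Lemma H_unit z : U z -> H z \in unitmx.
Proof. by move=> zU; apply: hform_unitmx => v; exact: Hpos. Qed.

Lemma fund_invE z eta : U z -> fund_inv F z eta = (r z)^-1 *: invmx (H z).
Proof.
move=> zU; rewrite /fund_inv fundE // invmxZ // unitmxZ ?H_unit //.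
by rewrite unitfE r0.
Qed.

Lemma nearU z : U z -> \forall x \near z, U x.
Proof. by move=> zU; exact: open_nbhs_nbhs. Qed.

Lemma dz_fund j l m z eta : U z ->
  dz j (fun x => fund F x eta l m) z =
  dz j r z * H z l m + r z * dz j (fun x => H x l m) z.
Proof.
move=> zU; rewrite -(dz_val (has_dzM (dr j zU) (dH j l m zU))).
by apply: near_dz; apply: filterS (nearU zU) => x xU; rewrite fundE // mxE.
Qed.

Lemma H_inv z l i : U z -> \sum_m H z l m * invmx (H z) m i = (l == i)%:R.
Proof.
move=> zU; have /matrixP/(_ l i) := mulmxV (H_unit zU).
by rewrite !mxE.
Qed.

(** In $(rH)^{-1}\partial_j(rH)$ the factor [r] cancels except in $r^{-1}\partial_j r$, which
    multiplies the identity matrix. *)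
Lemma nconnE i j z eta : U z ->
  nconn F i j z eta = \sum_l (chern i l j z + dlog j z * (l == i)%:R) * eta 0 l.
Proof.
move=> zU; rewrite /nconn exchange_big; apply: eq_bigr => l _ /=.
rewrite -mulr_suml; congr (_ * _).
rewrite -(H_inv _ _ zU) mulr_sumr -big_split; apply: eq_bigr => m _ /=.
rewrite fund_invE // dz_fund // mxE /dlog.
move: (dz _ _ _) (dz _ _ _) (invmx _ _ _) (H z l m) (r0 zU) => a b c d.
by move: (r z) => x x0; field.
Qed.

Lemma lconnE i j k z eta : U z ->
  lconn F i j k z eta = chern i j k z + dlog k z * (j == i)%:R.
Proof.
move=> zU; rewrite /lconn; under eq_fun do rewrite nconnE //.
exact: dz_val (has_dz_linear _ _ _).
Qed.

Lemma sprayE i z eta : U z ->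
  spray F i z eta =
  hspray i z eta + 2^-1 * (\sum_j dlog j z * eta 0 j) * eta 0 i.
Proof.
move=> zU; rewrite /spray /hspray -mulrA -mulrDr; congr (_ * _).
rewrite mulr_suml -big_split; apply: eq_bigr => j _ /=.
rewrite nconnE // mulr_suml.
rewrite -[eta 0 i](sum_deltal (fun l => eta 0 l)) mulr_sumr.
rewrite -big_split; apply: eq_bigr => l _ /=.
ring.
Qed.

(** The factor [r] cancels between the metric and its inverse. The torsion changes by two Kronecker
    terms: the one in $\bar s_m$ gives the gradient times the squared norm, the one in $\bar s_j$ a
    multiple of [eta]. *)
Lemma theta_starE i z eta : U z ->
  theta_star F i z eta =
  htheta i z eta + (\sum_m invmx (H z) m i * (dlog m z)^*) * hform (H z) eta eta
  - (\sum_j dlog j z * eta 0 j)^* * eta 0 i.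
Proof.
move=> zU; rewrite /theta_star.
(* [T1] is the torsion of [H]; [T2] and [T3] come from the Kronecker parts of [lconn p j m] and
   [lconn p m j]. *)
pose T1 m h p j := invmx (H z) m i * H z h p *
  ((chern p j m z)^* - (chern p m j z)^*) * eta 0 h * (eta 0 j)^*.
pose T2 m h p j := (invmx (H z) m i * (dlog m z)^*) *
  (H z h p * eta 0 h * (eta 0 j)^* * (j == p)%:R).
pose T3 m h p j := (dlog j z * eta 0 j)^* *
  (H z h p * invmx (H z) m i * eta 0 h * (p == m)%:R).
have -> : \sum_m \sum_h \sum_p \sum_j
    fund_inv F z eta m i * fund F z eta h p
    * ((lconn F p j m z eta)^* - (lconn F p m j z eta)^*)
    * eta 0 h * (eta 0 j)^* =
  \sum_m \sum_h \sum_p \sum_j (T1 m h p j + T2 m h p j - T3 m h p j).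
  apply: eq_bigr => m _; apply: eq_bigr => h _; apply: eq_bigr => p _.
  apply: eq_bigr => j _; rewrite fund_invE // fundE // !lconnE // !mxE.
  rewrite /T1 /T2 /T3 (eq_sym p m).
  move: (chern p j m z) (chern p m j z) (dlog j z) (dlog m z) => a b c d.
  move: (invmx _ _ _) (H z h p) (r0 zU) (eta 0 h) (eta 0 j) => A B x0 e f.
  move: (r z) x0 => x x0.
  rewrite !rmorphD !rmorphM /= !conjC_nat.
  by move: (a^*) (b^*) (c^*) (d^*) (f^*) => ? ? ? ? ?; field.
under eq_bigr do under eq_bigr do under eq_bigr do rewrite sumrB big_split /=.
under eq_bigr do under eq_bigr do rewrite sumrB big_split /=.
under eq_bigr do rewrite sumrB big_split /=.
rewrite sumrB big_split /=; congr (_ + _ - _).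
  rewrite mulr_suml; apply: eq_bigr => m _; rewrite mulr_sumr.
  apply: eq_bigr => h _; rewrite mulr_sumr; apply: eq_bigr => p _.
  by rewrite -mulr_sumr sum_delta.
(* For [T3] the sum over [j] is moved outside; the Kronecker symbol then sets [p = m], and [H]
   contracts with its inverse to leave [h = i]. *)
rewrite rmorph_sum mulr_suml.
under eq_bigr do under eq_bigr do rewrite exchange_big /=.
under eq_bigr do rewrite exchange_big /=.
rewrite exchange_big /=; apply: eq_bigr => j _.
rewrite exchange_big /= -[eta 0 i](sum_deltal (fun h => eta 0 h)) mulr_sumr.
apply: eq_bigr => h _; rewrite -(H_inv _ _ zU) mulr_suml mulr_sumr.
apply: eq_bigr => m _; rewrite -mulr_sumr sum_delta; ring.
Qed.

End ConformalChange.

Lemma exists_other (n : nat) (k : 'I_n) : (2 <= n)%N -> exists l, l != k.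
Proof.
case: n k => [|[|n]] k // _; have [->|] := eqVneq k ord0.
  by exists ord_max.
by exists ord0; rewrite eq_sym.
Qed.

(** * Real-valued functions, constants, and connectedness *)

Section RealValued.
Context {R : realType} {m : nat}.
Local Notation C := (Cplx R).

Lemma rderive_is_rderivable (f : 'rV[C]_m -> C) v z d :
  is_rderive f v z d -> rderivable f v z.
Proof. by move=> [h1 h2]; split; [case: h1|case: h2]. Qed.

Lemma has_dz_rderivable k (f : 'rV[C]_m -> C) z a b :
  has_dz k f z a b -> forall d, rderivable f (rdir d k) z.
Proof.
by move=> [h1 h2] []; [move: h2|move: h1]; exact: rderive_is_rderivable.
Qed.

Lemma smooth_has_dz U k (f : 'rV[C]_m -> C) z :
  smooth_on U f -> U z -> has_dz k f z (dz k f z) (dzbar k f z).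
Proof.
by move=> /(_ 1%N)[_ h] zU; apply: has_dzP => b; case: (h b k) => + _; exact.
Qed.

Lemma rderivableV (q : 'rV[C]_m -> R) v z : q z != 0 ->
  rderivable (fun x => (q x)%:C : C) v z ->
  rderivable (fun x => ((q x)^-1)%:C : C) v z.
Proof.
move=> q0 [h _]; split => /=; last exact: derivable_cst.
by apply: derivableV => //; rewrite rline0.
Qed.

(** With $\partial q = 0$ and $w = \bar\partial q$, the derivatives in the directions $x^k$ and
    $y^k$ are $w$ and $-iw$. Both are real, so $w = 0$. *)
Lemma real_dz_eq0 (q : 'rV[C]_m -> R) k z :
  (forall b, rderivable (fun x => (q x)%:C : C) (rdir b k) z) ->
  dz k (fun x => (q x)%:C : C) z = 0 ->
  forall b, is_rderive (fun x => (q x)%:C : C) (rdir b k) z 0.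
Proof.
move=> /has_dzP[+ + e]; rewrite e; move: (dzbar _ _ _) => w h1 h2.
have im v d : is_rderive (fun x => (q x)%:C : C) v z d -> complex.Im d = 0.
  move=> [_ h]; rewrite -(@derive_val _ _ _ _ _ _ _ h) /=.
  exact: derive_cst.
have iN (x : C) : complex.Im ('i * (0 - x)) = - complex.Re x.
  by rewrite sub0r ImM; case: x => a b /=; rewrite mul0r add0r mul1r.
have w0 : w = 0.
  apply: Cplx_eqP; last by move: (im _ _ h1); rewrite add0r.
  by move: (im _ _ h2); rewrite iN => /eqP; rewrite oppr_eq0 => /eqP.
by move: h1 h2; rewrite w0 addr0 subr0 mulr0 => h1 h2 [].
Qed.

(** Supplies the smoothness of the zero function [P]. The induction is general in [c], since
    differentiation replaces [c] by 0. *)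
Lemma of_class_cst r (U : set 'rV[C]_m) (c : C) : of_class r U (fun=> c).
Proof.
elim: r c => [|r IH] c; (split; first by move=> z _; exact: cst_continuous).
  by [].
move=> b k.
split; first by move=> z _; exact: rderive_is_rderivable (is_rderive_cst c _ z).
have -> : rderive (fun=> c) (rdir b k) = fun=> 0 :> C; last exact: IH.
by apply/funext => z; exact: rderive_val (is_rderive_cst c _ z).
Qed.
End RealValued.

(** The level set of [f] through [p] is nonempty, open and closed. *)
Lemma locally_constant (T : topologicalType) (S : Type) (f : T -> S) :
  connected [set: T] -> (forall p, \forall q \near p, f q = f p) ->
  forall p q, f q = f p.
Proof.
move=> cT floc p q.
suff : [set x | f x = f p] = [set: T] by move=> /seteqP[_ /(_ q)]; exact.
apply: cT; first by exists p.
- exists [set x | f x = f p]; rewrite ?setTI // openE => x /= <-.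
  by rewrite /interior; exact: floc.
- exists [set x | f x = f p]; rewrite ?setTI // -openC openE => x /= xp.
  by rewrite /interior; apply: filterS (floc x) => y /= ->.
Qed.

(** The fourth power of the metric contributes $a^{-4}$ to the curvature and the fundamental tensor
    $a^2$. *)
Lemma scale_holo_curv (R : realType) (a b : R) (S : Cplx R) :
  a != 0 -> b != 0 ->
  - (4 / ((a * b) ^+ 4)%:C) * ((a ^+ 2)%:C * S) =
  ((a ^+ 2)^-1)%:C * (- (4 / (b ^+ 4)%:C) * S).
Proof.
move=> a0 b0; rewrite fmorphV !rmorphXn rmorphM /=.
have : (a%:C : Cplx R) != 0 by rewrite fmorph_eq0.
have : (b%:C : Cplx R) != 0 by rewrite fmorph_eq0.
by move: (a%:C : Cplx R) (b%:C : Cplx R) S => x y s y0 x0; field; rewrite x0 y0.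
Qed.

(** * The local formulas in the charts of the manifold *)

Section ConformalMetric.
Context {R : realType} {n : nat} (M : complexManifold R n).
Local Notation C := (Cplx R).
Variables (h : hermitianMetric M) (rho : M -> R).
Hypothesis rho_gt0 : forall p, 0 < rho p.
Local Notation rho2 i := (fun x => (rho (chart_inv i x) ^+ 2)%:C : C).
Hypothesis drho2 : forall i z b k, chart_cod i z ->
  rderivable (rho2 i) (rdir b k) z.
Local Notation F := (conformal_metric h rho).

Lemma hnorm_sqrC i z v : chart_cod i z ->
  (hnorm (h i z) v ^+ 2)%:C = hform (h i z) v v.
Proof.
move=> zi; have [->|v0] := eqVneq v 0.
  by rewrite /hnorm hform0r /= sqrtr0 expr0n.
have v1 := hcoef_pos h zi v0.
have := v1; rewrite ltcE /= => /andP[_ v2].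
rewrite /hnorm sqr_sqrtr ?ltW //.
by apply: RRe_real; exact: gtr0_real.
Qed.

Lemma conformal_sqrC i z v : chart_cod i z ->
  (F i z v ^+ 2)%:C = rho2 i z * hform (h i z) v v.
Proof. by move=> zi; rewrite -hnorm_sqrC // -rmorphM -exprMn. Qed.

Lemma hcoef_dz i j k l z : chart_cod i z ->
  has_dz j (fun x => h i x k l) z (dz j (fun x => h i x k l) z)
    (dzbar j (fun x => h i x k l) z).
Proof. exact: smooth_has_dz (hcoef_smooth h i k l). Qed.

Lemma rho2_dz i j z : chart_cod i z ->
  has_dz j (rho2 i) z (dz j (rho2 i) z) (dzbar j (rho2 i) z).
Proof. by move=> zi; apply: has_dzP => b; exact: drho2. Qed.

Lemma rho2_neq0 i z : chart_cod i z -> rho2 i z != 0.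
Proof.
move=> _; apply/eqP => /(congr1 (@complex.Re R)) /= /eqP.
by rewrite sqrf_eq0 gt_eqF.
Qed.

Lemma conformal_fund i z eta : chart_cod i z ->
  fund (F i) z eta = rho2 i z *: h i z.
Proof. exact: (fundE (@conformal_sqrC i)). Qed.

Lemma conformal_spray i k z eta : chart_cod i z ->
  spray (F i) k z eta = hspray (h i) k z eta
    + 2^-1 * (\sum_j dlog (rho2 i) j z * eta 0 j) * eta 0 k.
Proof.
exact: (sprayE (@chart_cod_open _ _ M i) (@hcoef_dz i) (@rho2_dz i)
  (@hcoef_pos _ _ _ h i) (@rho2_neq0 i) (@conformal_sqrC i)).
Qed.

Lemma conformal_theta i k z eta : chart_cod i z ->
  theta_star (F i) k z eta = htheta (h i) k z eta
    + (\sum_m invmx (h i z) m k * (dlog (rho2 i) m z)^*) * hform (h i z) eta eta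
    - (\sum_j dlog (rho2 i) j z * eta 0 j)^* * eta 0 k.
Proof.
exact: (theta_starE (@chart_cod_open _ _ M i) (@hcoef_dz i) (@rho2_dz i)
  (@hcoef_pos _ _ _ h i) (@rho2_neq0 i) (@conformal_sqrC i)).
Qed.

Lemma dlog_cst i j z c : (forall p, rho p = c) -> dlog (rho2 i) j z = 0.
Proof.
move=> hc; rewrite /dlog; under eq_fun do rewrite hc.
by rewrite (dz_val (has_dz_cst _ _ _)) mul0r.
Qed.

Lemma conformal_spray_cst i k z eta c : (forall p, rho p = c) ->
  chart_cod i z -> spray (F i) k z eta = hspray (h i) k z eta.
Proof.
move=> hc zi; rewrite conformal_spray //.
by under eq_bigr do rewrite (dlog_cst _ _ _ hc) mul0r; rewrite sumr_const mul0rn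
  mulr0 mul0r addr0.
Qed.

Lemma conformal_theta_cst i k z eta c : (forall p, rho p = c) ->
  chart_cod i z -> theta_star (F i) k z eta = htheta (h i) k z eta.
Proof.
move=> hc zi; rewrite conformal_theta //.
under eq_bigr do rewrite (dlog_cst _ _ _ hc) rmorph0 mulr0.
under [in X in _ - X]eq_bigr do rewrite (dlog_cst _ _ _ hc) mul0r.
by rewrite !sumr_const !mul0rn rmorph0 !mul0r subr0 addr0.
Qed.

(** The curvature differentiates the spray in [z], so the sprays are compared on the whole chart and
    not only at [z]. *)
Lemma conformal_holo_curv i z eta (F' : tangent_fun M R) :
  (forall k z', chart_cod i z' ->
     spray (F i) k z' eta = spray (F' i) k z' eta) ->
  chart_cod i z -> fund (F' i) z eta = h i z -> F' i z eta != 0 ->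
  F i z eta = rho (chart_inv i z) * F' i z eta ->
  holo_curv (F i) z eta =
  ((rho (chart_inv i z) ^+ 2)^-1)%:C * holo_curv (F' i) z eta.
Proof.
move=> hs zi fE n0 FE; rewrite /holo_curv conformal_fund // fE FE.
rewrite -scale_holo_curv // ?(gt_eqF (rho_gt0 _)) //; congr (_ * _).
rewrite mulr_sumr; apply: eq_bigr => k _.
rewrite mulr_sumr; apply: eq_bigr => m _.
rewrite mulr_sumr; apply: eq_bigr => l _.
rewrite mxE.
have scale (c x y y' u v : C) : y = y' ->
    c * x * y * u * v = c * (x * y' * u * v) by move=> ->; rewrite !mulrA.
apply: scale; apply: near_dzbar.
apply: filterS (nearU (@chart_cod_open _ _ M i) zi).
by move=> x; exact: hs.
Qed.

End ConformalMetric.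

(** * Projective relatedness forces a constant conformal factor *)

Section ProjectiveConformal.
Context {R : realType} {n : nat} (M : complexManifold R n).
Local Notation C := (Cplx R).
Variables (h : hermitianMetric M) (rho : M -> R).
Hypothesis rho_gt0 : forall p, 0 < rho p.
Local Notation rho2 i := (fun x => (rho (chart_inv i x) ^+ 2)%:C : C).
Hypothesis drho2 : forall i z b k, chart_cod i z ->
  rderivable (rho2 i) (rdir b k) z.
Local Notation F := (conformal_metric h rho).

(** Makes the formulas for [h] the case of factor 1 of those for [F]. *)
Lemma norm_metricE : norm_metric h = conformal_metric h (fun=> 1).
Proof.
apply/funext => i; apply/funext => z; apply/funext => eta.
by rewrite /conformal_metric mul1r.
Qed.

Lemma one_rderivable (i : chart_idx M) (z : 'rV[C]_n) b k : chart_cod i z ->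
  rderivable (fun=> (1 ^+ 2 : R)%:C : C) (rdir b k) z.
Proof.
move=> _; exact: rderive_is_rderivable (is_rderive_cst ((1 ^+ 2)%:C : C) _ z).
Qed.

Lemma norm_spray i k z eta : chart_cod i z ->
  spray (norm_metric h i) k z eta = hspray (h i) k z eta.
Proof.
rewrite norm_metricE; exact: (@conformal_spray_cst R n M h (fun=> 1)
  (fun=> ltr01) one_rderivable i k z eta 1 (fun=> erefl)).
Qed.

Lemma norm_theta i k z eta : chart_cod i z ->
  theta_star (norm_metric h i) k z eta = htheta (h i) k z eta.
Proof.
rewrite norm_metricE; exact: (@conformal_theta_cst R n M h (fun=> 1)
  (fun=> ltr01) one_rderivable i k z eta 1 (fun=> erefl)).
Qed.

Lemma norm_fund i z eta : chart_cod i z ->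
  fund (norm_metric h i) z eta = h i z.
Proof.
by rewrite norm_metricE => zi; rewrite conformal_fund // expr1n scale1r.
Qed.

(** In the [k]-th component of the relation at a coordinate vector [eta] with [eta 0 k = 0], every
    multiple of [eta] drops out, including the term in [P]. What remains is the gradient component
    times the squared norm of [eta]. *)
Lemma projective_dz_eq0 i j z : (2 <= n)%N ->
  projectively_related F (norm_metric h) -> chart_cod i z ->
  dz j (rho2 i) z = 0.
Proof.
move=> n2 [P [_ hP]] zi.
have grad0 k : \sum_m invmx (h i z) m k * (dlog (rho2 i) m z)^* = 0.
  have [l lk] := exists_other k n2.
  pose eta : 'rV[C]_n := delta_mx 0 l.
  have etak : eta 0 k = 0 by rewrite mxE eqxx /= eq_sym (negPf lk).
  have eta0 : eta != 0.
    apply/eqP => /rowP/(_ l); rewrite !mxE !eqxx => /eqP.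
    by rewrite oner_eq0.
  (* Here [s] and [t] stand for the spray and torsion of [h], [A] for the gradient component, [q]
     for the squared norm; the zeros are [eta 0 k]. *)
  have solve (s t x y u A q : C) : q != 0 -> s =
      s + 2^-1 * x * 0 + 2^-1 * (t - (t + A * q - y * 0)) + u * 0 -> A = 0.
    move=> q0 e; have : A * q = 2 * (s - s) by rewrite [X in _ - X]e; field.
    rewrite subrr mulr0.
    by move=> /eqP; rewrite mulf_eq0 (negPf q0) orbF => /eqP.
  have q0 : hform (h i z) eta eta != 0 by rewrite gt_eqF // hcoef_pos.
  have := hP i z eta k zi eta0; rewrite norm_spray // norm_theta //.
  by rewrite conformal_spray // conformal_theta // etak; exact: solve.
have hu : h i z \in unitmx by apply: hform_unitmx => v; exact: hcoef_pos.
(* The gradient is this row times the inverse of [h]; multiplying by [h] recovers the row. *)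
have d0 : \row_m (dlog (rho2 i) m z)^* = 0.
  rewrite -[LHS](mulmxKV hu) -[RHS](mul0mx _ (h i z)); congr (_ *m _).
  apply/rowP => k; rewrite !mxE -[RHS](grad0 k); apply: eq_bigr => m _.
  by rewrite mxE mulrC.
have /rowP/(_ j) := d0; rewrite !mxE => /eqP; rewrite conjC_eq0 mulf_eq0.
rewrite invr_eq0 (negPf (rho2_neq0 _ zi)) // orbF => /eqP //.
Qed.

(** Row vectors carry the maximum norm, so balls are the polydiscs that [ball_const] works on. *)
Lemma ball_row (z x : 'rV[C]_n) (e : C) : 0 < e ->
  ball z e x <-> forall j, `|x 0 j - z 0 j| < e.
Proof.
move=> e0; split => [[_ h'] j|h'].
  by have := h' 0 j; rewrite -ball_normE /ball_ /= distrC.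
by split => // a j; rewrite ord1 -ball_normE /ball_ /= distrC.
Qed.

Lemma near_chart (i : chart_idx M) p (A : set 'rV[C]_n) : chart_dom i p ->
  nbhs (chart i p) A -> \forall q \near p, chart_dom i q /\ A (chart i q).
Proof.
move=> ip nA.
have nD : nbhs p (chart_dom i).
  by apply: open_nbhs_nbhs; split => //; exact: chart_dom_open.
have nB := @chart_cont _ _ M i p ip A nA.
by apply: filterS2 nD nB => q' qi qB; split.
Qed.

Lemma projective_constant : (2 <= n)%N -> connected [set: M] ->
  projectively_related F (norm_metric h) -> exists c, forall p, rho p = c.
Proof.
move=> n2 cM hP.
(* The empty space counts as connected; there any constant will do. *)
have [[p _]|M0] := pselect (exists p : M, True); last first.
  by exists 0 => p; case: M0; exists p.
exists (rho p) => q; apply: locally_constant => // {}p.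
have [i ip] := chart_cover p.
have zi := chart_in ip.
have /nbhs_ballP[e /= e0 he] := nearU (@chart_cod_open _ _ M i) zi.
have nB : nbhs (chart i p) (ball (chart i p) e).
  by apply/nbhs_ballP; exists e.
apply: filterS (near_chart ip nB) => q' [qi /(ball_row _ _ e0) qB].
pose r x := rho (chart_inv i x) ^+ 2.
have inb (x : 'rV[C]_n) : (forall j, `|x 0 j - chart i p 0 j| < e) ->
    chart_cod i x.
  by move=> xe; apply: he; apply/ball_row.
have : r (chart i q') = r (chart i p).
  apply: ball_const qB => x /inb xi b k.
  apply: real_dz_eq0 => [d|]; first exact: drho2.
  exact: projective_dz_eq0.
(* Equal squares give equal values because [rho] is positive. *)
by rewrite /r !chartK // => /eqP; rewrite eqrXn2 ?ltW // => /eqP.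
Qed.

End ProjectiveConformal.

(** * The conformal factor of the navigation problem *)

Section ConformalSolution.
Context {R : realType} {n : nat} (M : complexManifold R n).
Local Notation C := (Cplx R).
Variables (D : navigationData M) (phi : R) (rho : M -> R).
Hypothesis hsol : conformal_case D phi rho.
Local Notation h := (nav_metric D).
Local Notation W := (nav_wind D).
Local Notation speed := (nav_speed D).

Lemma speed_gt0 i z : chart_cod i z -> 0 < speed (chart_inv i z).
Proof.
move=> zi; have /andP[wu _] := nav_mild D zi.
by apply: le_lt_trans wu; exact: sqrtr_ge0.
Qed.

Lemma eps_tilde_gt0 i z : chart_cod i z -> 0 < eps_tilde D i z.
Proof.
move=> zi; have /andP[wu _] := nav_mild D zi.
by rewrite subr_gt0 ltr_pXn2r // nnegrE ?sqrtr_ge0 // ltW // speed_gt0.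
Qed.

Lemma speed_sqr_dz i k z : chart_cod i z -> exists a b,
  has_dz k (fun x => (speed (chart_inv i x) ^+ 2)%:C : C) z a b.
Proof.
move=> zi; have ds := smooth_has_dz k (nav_speed_smooth D i) zi.
do 2 eexists; under eq_fun do rewrite expr2 rmorphM.
exact: (has_dzM ds ds).
Qed.

Lemma eps_tilde_dz i k z : chart_cod i z -> exists a b,
  has_dz k (fun x => (eps_tilde D i x)%:C : C) z a b.
Proof.
move=> zi; have [a [b sd]] := speed_sqr_dz k zi.
have dW l := smooth_has_dz k (tcoef_smooth W i l) zi.
have wd := has_dz_sum (index_enum 'I_n) (P := xpredT) (fun l _ =>
  has_dz_sum (index_enum 'I_n) (P := xpredT) (fun m _ =>
    has_dzM (has_dzM (hcoef_dz h k l m zi) (dW l)) (has_dzJ (dW m)))).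
(* The squared norm of the wind is replaced by [hform], a sum of products of smooth coefficients;
   the two agree on the chart, hence near [z]. *)
do 2 eexists; apply: near_has_dz; last first.
  exact: has_dzD sd (has_dzM (has_dz_cst k (-1) z) wd).
apply: filterS (nearU (@chart_cod_open _ _ M i) zi) => x xi.
by rewrite /eps_tilde rmorphB /= mulN1r hnorm_sqrC.
Qed.

(** Treats both cases at once: [q] is the squared speed without wind and [eps_tilde] with wind. *)
Lemma conformal_caseE : exists q : chart_idx M -> 'rV[C]_n -> R,
  forall i z, chart_cod i z ->
  [/\ 0 < q i z, rho (chart_inv i z) = (Num.sqrt (q i z))^-1 &
    forall b k, rderivable (fun x => (q i x)%:C : C) (rdir b k) z].
Proof.
case: hsol => [[_ hr]|[_ _ hr]].
  exists (fun i x => speed (chart_inv i x) ^+ 2) => i z zi.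
  have s0 := speed_gt0 zi; split; first by rewrite exprn_gt0.
  - by rewrite hr // sqrtr_sqr gtr0_norm.
  - by move=> b k; have [? [? /has_dz_rderivable]] := speed_sqr_dz k zi.
exists (eps_tilde D) => i z zi; split; first exact: eps_tilde_gt0.
- exact: hr.
- by move=> b k; have [? [? /has_dz_rderivable]] := eps_tilde_dz k zi.
Qed.

Lemma solution_gt0 p : 0 < rho p.
Proof.
have [q hq] := conformal_caseE; have [i ip] := chart_cover p.
have [q0 e _] := hq i _ (chart_in ip).
by rewrite -(chartK ip) e invr_gt0 sqrtr_gt0.
Qed.

(** On the chart [rho ^+ 2] is the inverse of [q], so no square root is differentiated. *)
Lemma solution_rderivable i z b k : chart_cod i z ->
  rderivable (fun x => (rho (chart_inv i x) ^+ 2)%:C : C) (rdir b k) z.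
Proof.
move=> zi; have [q hq] := conformal_caseE; have [q0 _ dq] := hq i z zi.
have /rderivableP := rderivableV (lt0r_neq0 q0) (dq b k).
move=> dV; apply: rderive_is_rderivable; apply: near_is_rderive dV.
apply: filterS (nearU (@chart_cod_open _ _ M i) zi) => x xi.
by have [x0 -> _] := hq i x xi; rewrite exprVn sqr_sqrtr // ltW.
Qed.

(** Settles the mismatched case in the two equivalences below: the manifold is then empty and both
    sides hold. *)
Lemma chart_empty : wind_zero D -> wind_nowhere_zero D -> forall p : M, False.
Proof.
move=> w0 w1 p; have [i ip] := chart_cover p.
by have := w1 i _ (chart_in ip); rewrite w0 ?eqxx //; exact: chart_in.
Qed.

Lemma speed_constant : wind_zero D ->
  (exists c, forall p, rho p = c) <-> exists c, forall p, speed p = c.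
Proof.
move=> w0; case: hsol => [[_ hr]|[w1 _ _]]; last first.
  by split=> _; exists 0 => p; case: (chart_empty w0 w1 p).
have e p : rho p = (speed p)^-1.
  by have [i ip] := chart_cover p; rewrite -(chartK ip) hr //; exact: chart_in.
split=> -[c hc]; exists c^-1 => p; last by rewrite e hc.
by rewrite -(hc p) e invrK.
Qed.

Lemma eps_tilde_constant : wind_nowhere_zero D ->
  (exists c, forall p, rho p = c) <->
  exists c, forall i z, chart_cod i z -> eps_tilde D i z = c.
Proof.
move=> w1; case: hsol => [[w0 _]|[_ _ hr]].
  split=> _; exists 0.
    by move=> i z; case: (chart_empty w0 w1 (chart_inv i z)).
  by move=> p; case: (chart_empty w0 w1 p).
split=> -[c hc].
  (* Solves $c = 1/\sqrt{\tilde\varepsilon}$ for $\tilde\varepsilon$, which is positive. *)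
  exists (c ^- 2) => i z zi.
  rewrite -(hc (chart_inv i z)) hr // exprVn invrK sqr_sqrtr //.
  by rewrite ltW // eps_tilde_gt0.
exists (Num.sqrt c)^-1 => p; have [i ip] := chart_cover p.
by rewrite -(chartK ip) hr ?hc //; exact: chart_in.
Qed.

End ConformalSolution.

Unset Implicit Arguments.

Theorem theorem4p14 (R : realType) (n : nat) (hn : (2 <= n)%N)
    (M : complexManifold R n) (connM : connected [set: M])
    (D : navigationData M) (phi : R) (rho : M -> R)
    (hsol : conformal_solution D phi rho) :
  let h := norm_metric (nav_metric D) in
  let F := conformal_metric (nav_metric D) rho in
  let rho_constant := exists c : R, forall p : M, rho p = c in
  [/\ projectively_related F h <-> rho_constant,
      wind_zero D ->
        (rho_constant <-> exists c : R, forall p : M, nav_speed D p = c),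
      wind_nowhere_zero D -> cos phi = 0 ->
        (rho_constant <->
         exists c : R, forall i z, chart_cod i z -> eps_tilde D i z = c) &
      projectively_related F h \/ rho_constant ->
      forall i z eta, chart_cod i z -> eta != 0 ->
      [/\ forall k, spray (h i) k z eta = spray (F i) k z eta,
          forall k, theta_star (h i) k z eta = theta_star (F i) k z eta &
          holo_curv (F i) z eta =
            ((rho (chart_inv i z) ^+ 2)^-1)%:C * holo_curv (h i) z eta]].
Proof.
case: hsol => _ hc h F rho_constant.
have rho0 := solution_gt0 hc.
have drho2 := solution_rderivable hc.
have spray_eq c : (forall p, rho p = c) -> forall i k z eta, chart_cod i z ->
    spray (F i) k z eta = spray (h i) k z eta.
  move=> rc i k z eta zi; rewrite /h norm_spray //.
  exact: conformal_spray_cst rc zi.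
have theta_eq c : (forall p, rho p = c) -> forall i k z eta, chart_cod i z ->
    theta_star (F i) k z eta = theta_star (h i) k z eta.
  move=> rc i k z eta zi; rewrite /h norm_theta //.
  exact: conformal_theta_cst rc zi.
have proj_const : projectively_related F h <-> rho_constant.
  split=> [|[c rc]]; first exact: projective_constant.
  (* Sprays and torsions of the two metrics agree, which leaves [P = 0]. *)
  exists (fun _ _ _ => 0); split; first by split=> // i r; exact: of_class_cst.
  move=> i z eta k zi _; rewrite mul0r addr0.
  by rewrite (spray_eq c rc) // (theta_eq c rc) // subrr mulr0 addr0.
split; first exact: proj_const.
- by move=> w0; exact: (speed_constant hc w0).
- by move=> w1 _; exact: (eps_tilde_constant hc w1).
move=> hrc i z eta zi eta0.
have [c rc] : rho_constant by case: hrc => // /proj_const.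
split=> [k|k|].
- by apply/esym; exact: (spray_eq c rc).
- by apply/esym; exact: (theta_eq c rc).
apply: (@conformal_holo_curv _ _ _ _ _ rho0 i z eta h) => [|//|||].
- by move=> k z' zi'; exact: (spray_eq c rc).
- exact: norm_fund.
- by rewrite gt_eqF // sqrtr_gt0 hnorm_sqr.
- by [].
Qed.
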